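(* Let $M=(ST,AC,out_{AG},L)$ be a grand-coalition-first action model. The following three conditions are equivalent: (1) there is $r\in ST$ such that for every $a\in AG$ and $s\in ST$, there is a unique $\{a\}$-history from $r$ to $s$; (2) there is $r\in ST$ such that for every $C\subseteq AG$ and $s\in ST$, there is a unique $C$-history from $r$ to $s$; (3) there is $r\in ST$ such that for every $s\in ST$, there is a unique $AG$-history from $r$ to $s$.
   Context: $AG$ is a finite nonempty set of agents, $AP$ a countable set of atomic propositions. For a nonempty set $AC$ and $C\subseteq AG$, $JA_C$ is the set of functions $\sigma_C:C\to AC$ ($JA_\emptyset=\{\emptyset\}$); $\sigma_C\subseteq\sigma_{AG}$ means $\sigma_C$ is the restriction of $\sigma_{AG}$ to $C$. A grand-coalition-first action model is $(ST,AC,out_{AG},L)$ with $ST,AC$ nonempty, $out_{AG}:ST\times JA_{AG}\to\mathcal P(ST)$, $L:ST\to\mathcal P(AP)$. It determines $out_C(s,\sigma_C)=\bigcup\{out_{AG}(s,\sigma_{AG})\mid\sigma_C\subseteq\sigma_{AG}\}$ and $av_C(s)=\{\sigma_C\in JA_C\mid out_C(s,\sigma_C)\neq\emptyset\}$. For $C\subseteq AG$, a $C$-history from $s_0$ to $s_n$ is either the one-element sequence $(s_0)$ (a $C$-history from $s_0$ to $s_0$) or a finite sequence $(s_0,\sigma^1_C,s_1,\dots,\sigma^n_C,s_n)$, $n\ge1$, of states $s_i$ and joint actions $\sigma^i_C\in JA_C$ such that for every $0\le i<n$, $\sigma^{i+1}_C\in av_C(s_i)$ and $s_{i+1}\in out_C(s_i,\sigma^{i+1}_C)$.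 *)

(* Defs.v *)
From mathcomp Require Import all_boot.
From mathcomp Require Import classical_sets.

Set Implicit Arguments.
Unset Strict Implicit.
Unset Printing Implicit Defensive.

Local Open Scope classical_set_scope.

(* Finite functions, so that equality of joint actions is extensional. *)
Definition JA (AG : finType) (AC : Type) (C : {set AG}) : Type :=
  {ffun {a : AG | a \in C} -> AC}.

Definition subJA (AG : finType) (AC : Type) (C D : {set AG})
    (sC : JA AC C) (sD : JA AC D) : Prop :=
  forall (a : AG) (aC : a \in C),
    exists aD : a \in D, sC (exist _ a aC) = sD (exist _ a aD).

Record gcf_model (AG : finType) (AP : countType) : Type := GCFModel {
  ST : Type;
  AC : Type;
  ST_inhabited : inhabited ST;
  AC_inhabited : inhabited AC;
  out_AG : ST -> JA AC [set: AG]%SET -> set ST;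
  L : ST -> set AP
}.

Section Histories.
Variables (AG : finType) (AP : countType) (M : gcf_model AG AP).
Variable C : {set AG}.

Definition out (s : ST M) (sC : JA (AC M) C) : set (ST M) :=
  \bigcup_(sAG in [set sAG | subJA sC sAG]) out_AG s sAG.

Definition av (s : ST M) : set (JA (AC M) C) :=
  [set sC | out s sC !=set0].

(* (s_0, [:: (sigma^1, s_1); ...; (sigma^n, s_n)]) stands for the alternating
   sequence (s_0, sigma^1, s_1, ..., sigma^n, s_n). *)
Definition alt_seq : Type := (ST M * seq (JA (AC M) C * ST M))%type.

Fixpoint history_steps (s : ST M) (l : seq (JA (AC M) C * ST M)) : Prop :=
  if l is (sC, t) :: l' then
    [/\ av s sC, out s sC t & history_steps t l']
  else True.

Definition is_history (s t : ST M) (h : alt_seq) : Prop :=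
  [/\ h.1 = s, last h.1 (unzip2 h.2) = t & history_steps h.1 h.2].

Definition unique_history (s t : ST M) : Prop :=
  exists! h : alt_seq, is_history s t h.

End Histories.

(* Main.v *)
(** Forgetting the actions of the agents outside [C] maps the AG-histories from
    [s] to [t] onto the C-histories from [s] to [t], so existence and uniqueness
    of histories pass from AG to every [C]. Conversely, since there is an agent,
    an AG-history is determined by its restrictions to all the singletons, so
    uniqueness for the singletons gives uniqueness for AG. The same root works
    in all three conditions. *)
Require Import Defs.
From mathcomp Require Import all_boot.

Set Implicit Arguments.
Unset Strict Implicit.
Unset Printing Implicit Defensive.

Section Restriction.
Variables (AG : finType) (AP : countType) (M : gcf_model AG AP).
Implicit Types (C : {set AG}) (s t r : ST M).

Definition restrict C (f : JA (Defs.AC M) [set: AG]) : JA (Defs.AC M) C :=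
  [ffun x => f (exist _ (val x) (in_setT (val x)))].

Definition restrict_steps C :=
  map (fun p : JA (Defs.AC M) [set: AG] * ST M => (restrict C p.1, p.2)).

Definition restrict_seq C (h : alt_seq M [set: AG]) : alt_seq M C :=
  (h.1, restrict_steps C h.2).

(** Turns extension into an equation: [out s f] becomes the union of [out_AG s g] over the fibre of
    [restrict C] above [f]. *)
Lemma subJA_restrict C (f : JA (Defs.AC M) C) g : subJA f g <-> f = restrict C g.
Proof.
split=> [fg | -> a aC].
  apply/ffunP => -[a aC]; rewrite ffunE /=; have [aT ->] := fg a aC.
  by congr (g (exist _ a _)); apply: bool_irrelevance.
by exists (in_setT a); rewrite ffunE.
Qed.

Lemma restrict_setT f : restrict [set: AG] f = f.
Proof.
apply/ffunP => -[a aT]; rewrite ffunE.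
by congr (f (exist _ a _)); apply: bool_irrelevance.
Qed.

Lemma outP C s (f : JA (Defs.AC M) C) t :
  out s f t <-> exists2 g, f = restrict C g & out_AG s g t.
Proof.
by split=> -[g /subJA_restrict fg gt]; exists g => //; apply/subJA_restrict.
Qed.

Lemma out_setT s f t : out (C := [set: AG]) s f t <-> out_AG s f t.
Proof.
split=> [/outP[g ->]|ft]; first by rewrite restrict_setT.
by apply/outP; exists f; rewrite ?restrict_setT.
Qed.

Lemma history_steps_restrict C s l :
  history_steps (C := [set: AG]) s l -> history_steps s (restrict_steps C l).
Proof.
elim: l s => [//|[f t] l IHl] s /= [_ /out_setT ft /IHl lt].
have Cft : out s (restrict C f) t by apply/outP; exists f.
(* The successor [t] itself witnesses that the restricted action is available. *)
by split=> //; exists t.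
Qed.

(** Each step can be lifted on its own: some extension of its action reaches the same successor, so
    the states do not change and the lifted steps still chain. *)
Lemma history_steps_lift C s (l : seq (JA (Defs.AC M) C * ST M)) :
  history_steps s l ->
  exists2 l', history_steps (C := [set: AG]) s l' & restrict_steps C l' = l.
Proof.
elim: l s => [|[f t] l IHl] s /=; first by exists [::].
case=> _ /outP[g -> /out_setT gt] /IHl[l' l't <-].
by exists ((g, t) :: l') => //=; split=> //; exists t.
Qed.

Lemma unzip2_restrict_steps C l : unzip2 (restrict_steps C l) = unzip2 l.
Proof. by rewrite /unzip2 -map_comp. Qed.

Lemma is_history_restrict C s t h :
  is_history s t h -> is_history s t (restrict_seq C h).
Proof.
case: h => s0 l [/= s0E tE /(history_steps_restrict C)].
by split=> //=; rewrite unzip2_restrict_steps.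
Qed.

Lemma is_history_lift C s t (h : alt_seq M C) :
  is_history s t h -> exists2 h', is_history s t h' & restrict_seq C h' = h.
Proof.
case: h => s0 l [/= s0E tE /history_steps_lift[l' l't l'E]].
exists (s0, l'); last by rewrite /restrict_seq l'E.
by split=> //=; rewrite -(unzip2_restrict_steps C) l'E.
Qed.

(** The singletons cover all agents, and the restriction to [[set a]] records the action of [a]. *)
Lemma restrict_set1_inj f g :
  (forall a, restrict [set a] f = restrict [set a] g) -> f = g.
Proof.
move=> fg; apply/ffunP => -[a aT].
have /ffunP/(_ (exist _ a (set11 a))) := fg a; rewrite !ffunE /=.
by rewrite (bool_irrelevance (in_setT a) aT).
Qed.

Lemma restrict_seq_set1_inj (a0 : AG) h1 h2 :
  (forall a, restrict_seq [set a] h1 = restrict_seq [set a] h2) -> h1 = h2.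
Proof.
case: h1 h2 => [s1 l1] [s2 l2] h12; have [-> _] := h12 a0; congr pair.
have {h12}: forall a, restrict_steps [set a] l1 = restrict_steps [set a] l2.
  by move=> a; have [_] := h12 a.
(* Restriction keeps the length, so the view of [a0] alone rules out an empty list against a
   nonempty one. *)
elim: l1 l2 => [|[f s] l1 IHl] [|[g t] l2] // l12; try by have := l12 a0.
have [_ -> _] := l12 a0; rewrite (@restrict_set1_inj f g).
  by rewrite (IHl l2) // => a; have [] := l12 a.
by move=> a; have [] := l12 a.
Qed.

Lemma unique_history_restrict C s t :
  unique_history [set: AG] s t -> unique_history C s t.
Proof.
case=> h [hist_h uniq_h]; exists (restrict_seq C h).
split=> [|_ /is_history_lift[h' /uniq_h <- <- //]].
exact: is_history_restrict.
Qed.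

Lemma unique_history_setT (a0 : AG) s t :
  (forall a, unique_history [set a] s t) -> unique_history [set: AG] s t.
Proof.
(* For existence, lifting the history of the single agent [a0] is enough. *)
move=> uniq1; have [h0 [/is_history_lift[h hist_h _] _]] := uniq1 a0.
exists h; split=> // h' hist_h'; apply: (restrict_seq_set1_inj a0) => a.
have [ha [_ uniq_ha]] := uniq1 a.
rewrite -(uniq_ha _ (is_history_restrict _ hist_h)).
by rewrite (uniq_ha _ (is_history_restrict _ hist_h')).
Qed.

End Restriction.

Theorem theorem6p3 (AG : finType) (AP : countType) (AG_nonempty : 0 < #|AG|)
    (M : gcf_model AG AP) :
  ((exists r : ST M, forall (a : AG) (s : ST M), unique_history [set a] r s)
   <->
   (exists r : ST M, forall (C : {set AG}) (s : ST M), unique_history C r s))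
  /\
  ((exists r : ST M, forall (C : {set AG}) (s : ST M), unique_history C r s)
   <->
   (exists r : ST M, forall s : ST M, unique_history [set: AG] r s)).
Proof.
have /card_gt0P[a0 _] := AG_nonempty.
split; split=> -[r uniq_r]; exists r => //.
(* From singletons to an arbitrary [C] the way leads up to the grand coalition and down again. *)
- move=> C s; apply: unique_history_restrict.
  by apply: (unique_history_setT a0).
- by move=> C s; apply: unique_history_restrict.
Qed.
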